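(* Let $\mathcal{E}$ be a nonzero indecomposable nilpotent evolution algebra, of dimension at most four, over an algebraically closed field $\mathbb{F}$ of characteristic not two, and fix $i\in\mathbb{F}$ with $i^2=-1$. Then $\mathcal{E}$ is isomorphic to one and only one of the following evolution algebras, each given by the squares of the elements of a natural basis $\{e_1,\ldots,e_d\}$, $d=\dim\mathcal{E}$ (products $e_je_k$ with $j\neq k$ are $0$, and squares not listed are $0$): Dimension 1: (type $[1]$) $e_1^2=0$. Dimension 2: (type $[1,1]$) $e_1^2=e_2$. Dimension 3: - (type $[1,2]$) $e_1^2=e_2^2=e_3$; - (type $[1,1,1]$) $e_1^2=e_2$, $e_2^2=e_3$. Dimension 4: - (type $[1,3]$) $e_1^2=e_2^2=e_3^2=e_4$; - (type $[1,2,1]$) $e_1^2=e_2$, $e_2^2=e_3^2=e_4$; - (type $[1,2,1]$) $e_1^2=e_2+i\,e_3$, $e_2^2=e_3^2=e_4$; - (type $[1,1,2]$) $e_1^2=e_2^2=e_3$, $e_3^2=e_4$; - (type $[1,1,2]$) $e_1^2=e_3$, $e_2^2=e_3+e_4$, $e_3^2=e_4$; - (type $[1,1,1,1]$) $e_1^2=e_2$, $e_2^2=e_3$, $e_3^2=e_4$; - (type $[1,1,1,1]$) $e_1^2=e_2+e_3$, $e_2^2=e_3$, $e_3^2=e_4$.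
   Context: An evolution algebra (finite-dimensional here) is an algebra $\mathcal{E}$ over $\mathbb{F}$ with a basis $\{e_1,\ldots,e_n\}$ (a natural basis) such that $e_je_k=0$ for $j\neq k$; it is automatically commutative, and need not be associative. An algebra is decomposable if it is the direct sum of two nonzero ideals, and indecomposable otherwise. For an algebra $\mathcal{A}$, $\mathrm{ann}(\mathcal{A})=\{x\in\mathcal{A}: x\mathcal{A}=\mathcal{A}x=0\}$, $\mathrm{ann}^0(\mathcal{A})=0$, and $\mathrm{ann}^j(\mathcal{A})$ is defined by $\mathrm{ann}^j(\mathcal{A})/\mathrm{ann}^{j-1}(\mathcal{A})=\mathrm{ann}(\mathcal{A}/\mathrm{ann}^{j-1}(\mathcal{A}))$. With $\mathcal{A}^1=\mathcal{A}$ and $\mathcal{A}^{k+1}=\sum_{j=1}^k\mathcal{A}^j\mathcal{A}^{k+1-j}$, $\mathcal{A}$ is nilpotent if $\mathcal{A}^m=0$ for some $m$, equivalently $\mathrm{ann}^r(\mathcal{A})=\mathcal{A}$ for some $r$. The type of a finite-dimensional nilpotent algebra $\mathcal{A}$ is the sequence $[n_1,\ldots,n_r]$, where $r$ is the least natural number with $\mathrm{ann}^r(\mathcal{A})=\mathcal{A}$ and $n_j=\dim\mathrm{ann}^j(\mathcal{A})-\dim\mathrm{ann}^{j-1}(\mathcal{A})$. *)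

(* Defs.v *)
From HB Require Import structures.
From mathcomp Require Import all_boot all_order all_algebra.

Set Implicit Arguments.
Unset Strict Implicit.
Unset Printing Implicit Defensive.

Import GRing.Theory.
Local Open Scope ring_scope.

(* Multiplication is only required to be bilinear: no associativity, no unit. *)
Record algebra (F : fieldType) := MkAlgebra {
  carrier :> vectType F;
  amul : {bilinear carrier -> carrier -> carrier}
}.

Definition isomorphic (F : fieldType) (A B : algebra F) : Prop :=
  exists2 f : 'Hom(A, B),
    bijective f & forall x y, f (amul A x y) = amul B (f x) (f y).

Section AlgebraTheory.
Variables (F : fieldType) (A : algebra F).
Implicit Types (U V W : {vspace A}) (x y : A).

Definition natural_basis n (e : n.-tuple A) : Prop :=
  basis_of fullv e /\
  forall j k : 'I_n, j != k -> amul A (tnth e j) (tnth e k) = 0.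

Definition evolution_algebra : Prop :=
  exists n (e : n.-tuple A), natural_basis e.

Definition ideal U : Prop :=
  forall x y, x \in U -> amul A x y \in U /\ amul A y x \in U.

Definition decomposable : Prop :=
  exists U V, [/\ ideal U, ideal V, U != 0%VS, V != 0%VS &
    (U + V)%VS = fullv /\ (U :&: V)%VS = 0%VS].

Definition mulv U V : {vspace A} :=
  <<[seq amul A x y | x <- vbasis U, y <- vbasis V]>>%VS.

Lemma mem_mulv U V x y : x \in U -> y \in V -> amul A x y \in mulv U V.
Proof.
move=> xU yV; rewrite (coord_vbasis xU) (coord_vbasis yV).
rewrite linear_sumlz memv_suml // => j _.
rewrite linear_sumr memv_suml // => k _.
rewrite linearZl_LR linearZr_LR !memvZ //; apply: memv_span.
by apply/allpairsP; exists ((vbasis U)`_j, (vbasis V)`_k);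
  rewrite /= !mem_nth ?size_tuple.
Qed.

Lemma mulv_subP U V W :
  (forall x y, x \in U -> y \in V -> amul A x y \in W) <-> (mulv U V <= W)%VS.
Proof.
split=> [UVW | /subvP sW x y xU yV]; last by rewrite sW ?mem_mulv.
apply/span_subvP=> z /allpairsP[[x y] /= [xU yV ->]].
by apply: UVW; apply: vbasis_mem.
Qed.

(* apow_seq n = [:: A^1; ...; A^n] *)
Fixpoint apow_seq n : seq {vspace A} :=
  if n is m.+1 then
    let s := apow_seq m in
    rcons s (if m is 0 then fullv
             else (\sum_(j < m) mulv (nth fullv s j) (nth fullv s (m.-1 - j)))%VS)
  else [::].

(* A^k for k > 0; the value at k = 0 is not meaningful. *)
Definition apow k : {vspace A} := nth fullv (apow_seq k) k.-1.

Lemma size_apow_seq n : size (apow_seq n) = n.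
Proof. by elim: n => //= n IHn; rewrite size_rcons IHn. Qed.

Lemma nth_apow_seq n j : (j < n)%N -> nth fullv (apow_seq n) j = apow j.+1.
Proof.
elim: n => // n IHn; rewrite ltnS leq_eqVlt => /predU1P[-> // | ltjn].
by rewrite /= nth_rcons size_apow_seq ltjn IHn.
Qed.

Lemma apow1 : apow 1 = fullv.
Proof. by []. Qed.

Lemma apowS k : (0 < k)%N ->
  apow k.+1 = (\sum_(1 <= j < k.+1) mulv (apow j) (apow (k.+1 - j)))%VS.
Proof.
case: k => // k _; rewrite big_add1 big_mkord.
rewrite -[LHS]/(nth fullv (rcons (apow_seq k.+1) _) k.+1) nth_rcons.
rewrite size_apow_seq ltnn eqxx; apply: eq_bigr => j _ /=.
have lejk: (j <= k)%N by rewrite -ltnS.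
have e1 : nth fullv (apow_seq k.+1) j = apow j.+1 by rewrite nth_apow_seq.
have e2 : nth fullv (apow_seq k.+1) (k - j) = apow (k - j).+1.
  by rewrite nth_apow_seq // ltnS leq_subr.
by rewrite -[rcons _ _]/(apow_seq k.+1) e1 e2 subSS subSn.
Qed.

Definition nilpotent : Prop := exists2 m, (0 < m)%N & apow m = 0%VS.

(* The preimage in A of the annihilator of A / V, see mem_ann_mod. *)
Definition ann_mod V : {vspace A} :=
  (\bigcap_(k < \dim (@fullv F A))
    ((linfun ((amul A)^~ (vbasis fullv)`_k) @^-1: V) :&:
     (linfun (amul A (vbasis fullv)`_k) @^-1: V)))%VS.

Lemma mem_ann_mod V x :
  x \in ann_mod V <-> forall y, amul A x y \in V /\ amul A y x \in V.
Proof.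
have linl y z : linfun ((amul A)^~ y) z = amul A z y.
  by rewrite -[RHS]/(applyr (amul A) y z) -[RHS]lfunE.
split=> [xV y | xV]; last first.
  rewrite memvE; apply/subv_bigcapP => k _; rewrite -memvE memv_cap.
  by rewrite -!memv_preim linl lfunE; apply/andP/xV.
have {}xV (k : 'I_(\dim (@fullv F A))) :
    amul A x (vbasis fullv)`_k \in V /\ amul A (vbasis fullv)`_k x \in V.
  move: xV; rewrite memvE => /subv_bigcapP/(_ k isT).
  by rewrite -memvE memv_cap -!memv_preim linl lfunE => /andP.
rewrite (coord_vbasis (memvf y)) linear_sumr linear_sumlz.
split; apply: memv_suml => k _.
  by rewrite linearZr_LR memvZ //; case: (xV k).
by rewrite linearZl_LR memvZ //; case: (xV k).
Qed.

Definition ann j : {vspace A} := iter j ann_mod 0%VS.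

Definition has_type (s : seq nat) : Prop :=
  [/\ ann (size s) = fullv,
      forall r, (r < size s)%N -> ann r <> fullv &
      forall j, (j < size s)%N ->
        nth 0%N s j = (\dim (ann j.+1) - \dim (ann j))%N].

End AlgebraTheory.

Section Concrete.
Variables (F : fieldType) (d : nat) (s : seq 'rV[F]_d).

(* The j-th basis vector, with indices starting at 1. *)
Definition e (j : nat) : 'rV[F]_d := \row_(k < d) (k.+1 == j)%:R.

Definition evo_mul (x y : 'rV[F]_d) : 'rV[F]_d :=
  \sum_(j < d) (x 0 j * y 0 j) *: s`_j.

Lemma evo_mul_bilinear : bilinear_for *:%R *:%R evo_mul.
Proof.
split=> [y | x] a u v; rewrite /= /evo_mul scaler_sumr -big_split /=;
  apply: eq_bigr => j _; rewrite !mxE.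
  by rewrite mulrDl scalerDl -mulrA scalerA.
by rewrite mulrDr scalerDl mulrCA scalerA.
Qed.

HB.instance Definition _ :=
  bilinear_isBilinear.Build F 'rV[F]_d 'rV[F]_d 'rV[F]_d *:%R *:%R evo_mul
    evo_mul_bilinear.

(* e_1, ..., e_d is a natural basis, e_j^2 is the j-th element of s, and it is 0
   for j beyond the length of s. *)
Definition evo : algebra F := @MkAlgebra F 'rV[F]_d evo_mul.

Lemma evo_mul_e j k : (0 < j <= d)%N ->
  amul evo (e j) (e k) = if j == k then s`_j.-1 else 0.
Proof.
case: j => // j /= ltjd; rewrite [LHS](bigD1 (Ordinal ltjd)) //= big1 => [|l].
  by rewrite !mxE /= eqxx mul1r addr0; case: eqP => _; rewrite ?scale1r ?scale0r.
rewrite -val_eqE /= !mxE eqSS => /negPf ->.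
by rewrite mul0r scale0r.
Qed.

End Concrete.

Arguments e {F d} j.
Arguments evo {F} d s.

Inductive label : Set :=
  | L1
  | L1_1
  | L1_2 | L1_1_1
  | L1_3 | L1_2_1 | L1_2_1' | L1_1_2 | L1_1_2' | L1_1_1_1 | L1_1_1_1'.

Definition label_algebra (F : fieldType) (i : F) (l : label) : algebra F :=
  match l with
  | L1        => evo 1 [::]
  | L1_1      => evo 2 [:: e 2]
  | L1_2      => evo 3 [:: e 3; e 3]
  | L1_1_1    => evo 3 [:: e 2; e 3]
  | L1_3      => evo 4 [:: e 4; e 4; e 4]
  | L1_2_1    => evo 4 [:: e 2; e 4; e 4]
  | L1_2_1'   => evo 4 [:: e 2 + i *: e 3; e 4; e 4]
  | L1_1_2    => evo 4 [:: e 3; e 3; e 4]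
  | L1_1_2'   => evo 4 [:: e 3; e 3 + e 4; e 4]
  | L1_1_1_1  => evo 4 [:: e 2; e 3; e 4]
  | L1_1_1_1' => evo 4 [:: e 2 + e 3; e 3; e 4]
  end.

Definition label_type (l : label) : seq nat :=
  match l with
  | L1                   => [:: 1]
  | L1_1                 => [:: 1; 1]
  | L1_2                 => [:: 1; 2]
  | L1_1_1               => [:: 1; 1; 1]
  | L1_3                 => [:: 1; 3]
  | L1_2_1 | L1_2_1'     => [:: 1; 2; 1]
  | L1_1_2 | L1_1_2'     => [:: 1; 1; 2]
  | L1_1_1_1 | L1_1_1_1' => [:: 1; 1; 1; 1]
  end%N.

(* Main.v *)
(* A nilpotent evolution algebra has a natural basis whose structure matrix is
   strictly upper triangular: otherwise, for some proper subset T of the basis,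
   all basis vectors outside T would have squares outside the span of T, and no
   power of the algebra could vanish. In dimension at most four this leaves at most six
   structure constants. Rescaling the basis, adding annihilator elements and
   rotating basis vectors with proportional squares brings each such matrix to
   one of the listed forms, unless a projection in the centroid splits the
   algebra; most splittings come from an annihilator element outside E^2.
   The type separates the listed algebras except for three pairs, which are
   separated by equations between iterated squares. *)

From HB Require Import structures.
Require Import Defs.
From mathcomp Require Import all_boot all_order all_algebra.
From mathcomp Require Import ring.


Set Implicit Arguments.
Unset Strict Implicit.

Import GRing.Theory.
Local Open Scope ring_scope.

(** * Invariance of type and decomposability under isomorphism *)

Lemma isomorphic_sym (F : fieldType) (A B : algebra F) :
  isomorphic A B -> isomorphic B A.
Proof.
case=> f [g fK gK] fM.
have f0 : lker f == 0%VS by apply/lker0P; apply: can_inj fK.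
have fiK y : f (f^-1%VF y) = y by rewrite -[y in LHS]gK lker0_lfunK ?gK.
exists (f^-1)%VF; first by exists f => // x; rewrite lker0_lfunK.
by move=> x y; apply: (can_inj fK); rewrite fM !fiK.
Qed.

Lemma isomorphic_trans (F : fieldType) (A B C : algebra F) :
  isomorphic A B -> isomorphic B C -> isomorphic A C.
Proof.
case=> f bf fM [g bg gM]; exists (g \o f)%VF => [|x y]; last first.
  by rewrite !lfunE /= fM gM.
by apply: (eq_bij (bij_comp bg bf)) => x; rewrite lfunE.
Qed.

Lemma ann_iso (F : fieldType) (A B : algebra F) (f : 'Hom(A, B)) j x :
  bijective f -> (forall x y, f (amul A x y) = amul B (f x) (f y)) ->
  (f x \in ann B j) = (x \in ann A j).
Proof.
move=> [g fK gK] fM; elim: j x => [|j IHj] x.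
  by rewrite !memv0 -(can_eq fK) linear0.
apply/idP/idP => /mem_ann_mod xV; apply/mem_ann_mod => y.
  by rewrite -!IHj !fM; apply: xV.
by rewrite -[y]gK -!fM !IHj; apply: xV.
Qed.

Lemma has_type_iso (F : fieldType) (A B : algebra F) s :
  isomorphic A B -> has_type A s -> has_type B s.
Proof.
case=> f bf fM; have [g fK gK] := bf.
have annE j : ann B j = (f @: ann A j)%VS.
  apply/vspaceP => y; apply/idP/memv_imgP => [yB | [x xA ->]].
    by exists (g y); rewrite ?gK // -(ann_iso _ _ bf fM) gK.
  by rewrite (ann_iso _ _ bf fM).
have f0 : lker f == 0%VS by apply/lker0P; apply: can_inj fK.
have fT : (f @: fullv)%VS = fullv.
  by apply/vspaceP => y; rewrite memvf; apply/memv_imgP; exists (g y); rewrite ?memvf.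
case=> sT sN sD; split=> [|r ltrs|j ltjs].
- by rewrite annE sT fT.
- rewrite annE -fT => /eqP; rewrite eq_limg_ker0 // => /eqP; exact: sN.
- by rewrite sD // !annE !limg_dim_eq // (eqP f0) capv0.
Qed.

Lemma has_type_inj (F : fieldType) (A : algebra F) s t :
  has_type A s -> has_type A t -> s = t.
Proof.
move=> [sT sN sD] [tT tN tD].
have st : size s = size t.
  case: (ltngtP (size s) (size t)) => // lt; first by case: (tN _ lt).
  by case: (sN _ lt).
by apply: (@eq_from_nth _ 0%N) => // j ltj; rewrite sD // tD // -st.
Qed.

Lemma decomposable_iso (F : fieldType) (A B : algebra F) :
  isomorphic A B -> decomposable A -> decomposable B.
Proof.
case=> f [g fK gK] fM [U [V [iU iV U0 V0 [UV UV0]]]].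
have f0 : lker f == 0%VS by apply/lker0P; apply: can_inj fK.
have idealI W : ideal W -> ideal (f @: W)%VS.
  move=> iW _ y /memv_imgP[x xW ->]; rewrite -[y]gK -!fM.
  by have [? ?] := iW x (g y) xW; rewrite !memv_img.
have imgN0 (W : {vspace A}) : W != 0%VS -> (f @: W)%VS != 0%VS.
  by rewrite -!dimv_eq0 limg_dim_eq // (eqP f0) capv0.
exists (f @: U)%VS, (f @: V)%VS; split; rewrite ?imgN0 //; try exact: idealI.
rewrite -limgD UV -lker0_img_cap // UV0 limg0; split=> //.
by apply/vspaceP => y; rewrite memvf; apply/memv_imgP; exists (g y); rewrite ?memvf.
Qed.

(* A nontrivial idempotent [P] of the centroid splits the algebra as the image
   of [P] plus its kernel. *)
Lemma decomposable_centroid (F : fieldType) (A : algebra F) (P : 'End(A)) :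
  (forall x, P (P x) = P x) -> P <> 0%VF -> P <> \1%VF ->
  (forall x y, P (amul A x y) = amul A (P x) y) ->
  (forall x y, P (amul A x y) = amul A x (P y)) -> decomposable A.
Proof.
move=> PP P0 P1 Pl Pr; exists (limg P), (lker P); split.
- move=> _ y /memv_imgP[x _ ->].
  by rewrite -Pl -Pr !memv_img ?memvf.
- by move=> x y; rewrite !memv_ker Pl Pr => /eqP->; rewrite linear0l linear0r.
- apply: contra_notN P0 => /eqP iP0; apply/lfunP => x; rewrite lfunE /=.
  by apply/eqP; rewrite -memv0 -iP0 memv_img ?memvf.
- apply: contra_notN P1 => /lker0P Pinj; apply/lfunP => x; rewrite lfunE /=.
  exact/Pinj/PP.
split.
  apply/vspaceP => x; rewrite memvf; apply/memv_addP.
  exists (P x); first by rewrite memv_img ?memvf.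
  exists (x - P x); last by rewrite addrC subrK.
  by rewrite memv_ker linearB /= PP subrr.
apply/eqP; rewrite -subv0; apply/subvP => x; rewrite memv_cap memv0.
by case/andP=> /memv_imgP[y _ ->]; rewrite memv_ker PP.
Qed.

(** * Triangular natural bases *)

Section NaturalBasis.
Variables (F : fieldType) (A : algebra F) (n : nat) (e : n.-tuple A).
Hypothesis nat_e : natural_basis e.

Let free_e : free e := basis_free nat_e.1.

Lemma natural_basis_coord x : x = \sum_(k < n) coord e k x *: tnth e k.
Proof.
rewrite [LHS](coord_basis nat_e.1 (memvf x)).
by apply: eq_bigr => k _; rewrite (tnth_nth 0).
Qed.

Lemma coord_tnth j k : coord e j (tnth e k) = (j == k)%:R.
Proof. by rewrite (tnth_nth 0) coord_free ?free_e // eq_sym. Qed.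

Lemma amul_natural_basis x y :
  amul A x y =
    \sum_(k < n) (coord e k x * coord e k y) *: amul A (tnth e k) (tnth e k).
Proof.
rewrite {1}[x]natural_basis_coord {1}[y]natural_basis_coord linear_sumlz.
apply: eq_bigr => k _; rewrite linear_sumr (bigD1 k) //= big1 ?addr0 => [|j jk].
  by rewrite linearZl_LR linearZr_LR scalerA.
by rewrite linearZl_LR linearZr_LR nat_e.2 1?eq_sym // !scaler0.
Qed.

(** [sigma] acts on both indices because reordering the basis conjugates the structure matrix by a
    permutation. *)
Definition structure_row (sigma : 'I_n -> 'I_n) (j : 'I_n) : 'rV[F]_n :=
  let x := tnth e (sigma j) in \row_k coord e (sigma k) (amul A x x).

Lemma isomorphic_evo_natural_basis (sigma : 'I_n -> 'I_n) : injective sigma ->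
  isomorphic A (evo n [seq structure_row sigma j | j <- enum 'I_n]).
Proof.
move=> inj_s.
pose f x : 'rV[F]_n := \row_k coord e (sigma k) x.
have f_lin : linear f by move=> a x y; apply/rowP => k; rewrite !mxE linearP.
pose fL := GRing.isLinear.Build F A 'rV[F]_n _ f f_lin.
pose f' : {linear A -> 'rV[F]_n} := HB.pack f fL.
pose g (v : 'rV[F]_n) := \sum_(k < n) v 0 k *: tnth e (sigma k).
have fK : cancel f g.
  move=> x; rewrite [RHS]natural_basis_coord (reindex sigma) /=; last first.
    exact/onW_bij/injF_bij.
  by apply: eq_bigr => k _; rewrite mxE.
have gK : cancel g f.
  move=> v; apply/rowP => k; rewrite mxE linear_sum (bigD1 k) //= big1 => [|j jk].
    by rewrite linearZ /= coord_tnth eqxx mulr1 addr0.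
  by rewrite linearZ /= coord_tnth (inj_eq inj_s) eq_sym (negPf jk) mulr0.
exists (linfun f' : 'Hom(A, evo n _)) => [|x y].
  by exists g => x; rewrite lfunE /= ?fK ?gK.
rewrite !lfunE /=; apply/rowP => k; rewrite mxE amul_natural_basis linear_sum.
rewrite (reindex sigma) /=; last exact/onW_bij/injF_bij.
rewrite summxE; apply: eq_bigr => j _; rewrite linearZ /= !mxE.
rewrite (nth_map j) ?size_enum_ord // nth_ord_enum mxE //.
Qed.

(* If every [e_k] with [k \notin T] had a square outside the span of
   [e_l, l \in T], every power of [A] would leave that span. *)
Lemma nilpotent_square_in (T : seq 'I_n) : nilpotent A ->
  (size T < n)%N -> exists2 k, k \notin T &
    forall l, l \notin T -> coord e l (amul A (tnth e k) (tnth e k)) = 0.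
Proof.
move=> [m m0 Am0] ltTn.
pose P k := [forall l, (l \notin T) ==>
  (coord e l (amul A (tnth e k) (tnth e k)) == 0)].
suff /existsP[k /andP[kT /forall_inP Pk]] : [exists k, (k \notin T) && P k].
  by exists k => // l lT; apply/eqP/Pk.
apply: contraLR isT => /existsPn noP.
have out k : k \notin T ->
    exists2 l, l \notin T & coord e l (amul A (tnth e k) (tnth e k)) != 0.
  move=> kT; have:= noP k; rewrite kT /= negb_forall_in.
  by case/exists_inP => l lT l0; exists l.
have [k0 k0T] : exists k, k \notin T.
  apply/existsP; apply: contraLR ltTn => /existsPn allT; rewrite -leqNgt.
  rewrite -{1}[n]card_ord (leq_trans _ (card_size T)) //.
  by apply/subset_leq_card/subsetP => k _; apply/negPn/allT.
suff [x] : exists2 x, x \in apow A m & exists2 l, l \notin T & coord e l x != 0.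
  by rewrite Am0 memv0 => /eqP-> [l _]; rewrite linear0 eqxx.
elim: m m0 {Am0} => // -[_ _ | m IHm _].
  exists (tnth e k0); first exact: memvf.
  by exists k0; rewrite // coord_tnth eqxx oner_eq0.
have [// | x xA [k kT xk]] := IHm; have [l lT l0] := out k kT.
(* Multiplying by [e_k] isolates [x_k e_k^2], whose [l]-coordinate is nonzero. *)
exists (amul A x (tnth e k)); last first.
  exists l => //; rewrite amul_natural_basis linear_sum (bigD1 k) //= big1.
    by rewrite linearZ /= coord_tnth eqxx mulr1 addr0 mulf_neq0.
  by move=> j jk; rewrite coord_tnth (negPf jk) mulr0 scale0r linear0.
(* The last summand of the next power is the product of the current power with [A] itself. *)
rewrite apowS // big_nat_recr //= subSnn.
by apply: (subvP (addvSr _ _)); apply: mem_mulv; rewrite ?apow1 ?memvf.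
Qed.

(** The order is built from its end. The list [T] spans a subspace containing the squares of its
    members; [nilpotent_square_in] supplies a new vector whose square lies in that span, and
    prepending it preserves the invariant [good]. *)
Lemma nilpotent_ordering : nilpotent A -> exists2 sigma : 'I_n -> 'I_n,
  injective sigma & forall j k : 'I_n, (k <= j)%N -> structure_row sigma j 0 k = 0.
Proof.
move=> nilA; pose r j l := coord e l (amul A (tnth e j) (tnth e j)) == 0.
pose good T := [/\ uniq T, pairwise (fun k j => r j k) T, all (fun j => r j j) T
  & forall j l, j \in T -> l \notin T -> r j l].
suff [T [uT pT rT _] sT] : exists2 T, good T & size T = n.
  pose sigma j := tnth (tcast sT (in_tuple T)) j.
  have sigmaE x0 j : sigma j = nth x0 T j.
    by rewrite /sigma (tnth_nth x0) val_tcast.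
  exists sigma => [j k|j k]; rewrite ?mxE; rewrite !(sigmaE j).
    by move/eqP; rewrite nth_uniq ?sT // => /eqP/val_inj.
  rewrite leq_eqVlt => /predU1P[/val_inj-> | ltkj]; apply/eqP.
    by rewrite -/(r _ _) (all_nthP j rT) ?sT.
  by apply: (pairwiseP j pT); rewrite // inE sT.
suff /(_ n (leqnn n)): forall m, (m <= n)%N -> exists2 T, good T & size T = m by [].
elim=> [_ | m IHm ltmn]; first by exists [::].
have [T [uT pT rT cT] sT] := IHm (ltnW ltmn).
have [|k kT Pk] := @nilpotent_square_in T nilA; first by rewrite sT.
exists (k :: T) => /=; last by rewrite sT.
have rk l : l \notin T -> r k l by move=> lT; apply/eqP/Pk.
split=> /=; rewrite ?kT ?rk ?pT ?andbT //; first by apply/allP => j jT; apply: cT.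
move=> j l; rewrite !inE negb_or => /predU1P[-> | jT] /andP[_ lT].
  exact: rk.
exact: cT.
Qed.

End NaturalBasis.

Lemma nilpotent_evolution_algebra (F : fieldType) (A : algebra F) :
  evolution_algebra A -> nilpotent A ->
  exists2 s : seq 'rV[F]_(\dim (@fullv F A)),
    forall j k : 'I_(\dim (@fullv F A)), (k <= j)%N -> s`_j 0 k = 0 &
    isomorphic A (evo _ s).
Proof.
move=> [n [e nat_e]] nilA; have [sigma inj_s tri_s] := nilpotent_ordering nat_e nilA.
have -> : \dim (@fullv F A) = n by rewrite (size_basis nat_e.1).
exists [seq structure_row e sigma j | j <- enum 'I_n].
  by move=> j k lekj; rewrite (nth_map j) ?size_enum_ord // nth_ord_enum tri_s.
exact: isomorphic_evo_natural_basis.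
Qed.

(** * Isomorphisms and splittings given by matrices *)

Definition rowl (F : fieldType) d (l : seq F) : 'rV[F]_d := \row_k l`_k.

Definition mxl (F : fieldType) d (l : seq (seq F)) : 'M[F]_d :=
  \matrix_(j, k) (nth [::] l j)`_k.

(** The rows of [M] are the basis with squares [s'] written in the basis with squares [s], so right
    multiplication by [M] maps the second algebra to the first. *)
Lemma isomorphic_evo (F : fieldType) d (s s' : seq 'rV[F]_d) (M N : 'M[F]_d) :
  M *m N = 1%:M ->
  (forall x y, evo_mul s' x y *m M = evo_mul s (x *m M) (y *m M)) ->
  isomorphic (evo d s) (evo d s').
Proof.
move=> MN1 mulM; apply: isomorphic_sym.
exists (linfun (mulmxr M) : 'Hom(evo d s', evo d s)) => [|x y].
  exists (mulmxr N) => x; rewrite lfunE /= -mulmxA ?MN1 ?mulmx1 //.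
  by rewrite (mulmx1C MN1) mulmx1.
by rewrite !lfunE /= mulM.
Qed.

Lemma isomorphic_evo_eq (F : fieldType) d (s s' : seq 'rV[F]_d) :
  (forall j, (j < d)%N -> s`_j = s'`_j) -> isomorphic (evo d s) (evo d s').
Proof.
move=> ss'; apply: (@isomorphic_evo _ _ _ _ 1%:M 1%:M); rewrite ?mulmx1 //.
by move=> x y; rewrite !mulmx1; apply: eq_bigr => j _; rewrite ss'.
Qed.

(** Commutativity turns the one-sided condition on [P] into both centroid identities. *)
Lemma decomposable_evo (F : fieldType) d (s : seq 'rV[F]_d) (P : 'M[F]_d) :
  P *m P = P -> P <> 0 -> P <> 1%:M ->
  (forall x y, evo_mul s x y *m P = evo_mul s (x *m P) y) ->
  decomposable (evo d s).
Proof.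
move=> PP P0 P1 mulP.
have PE : (linfun (mulmxr P) : 'End(evo d s)) =1 mulmxr P by move=> x; rewrite lfunE.
have evo_mulC x y : evo_mul s x y = evo_mul s y x.
  by apply: eq_bigr => j _; rewrite mulrC.
apply: (@decomposable_centroid _ (evo d s) (linfun (mulmxr P))).
- by move=> x; rewrite !PE /= -mulmxA PP.
- move=> /lfunP PE0; apply: P0; apply/row_matrixP => j.
  by have:= PE0 (delta_mx 0 j); rewrite PE lfunE /= -rowE row0.
- move=> /lfunP PE1; apply: P1; apply/row_matrixP => j.
  by have:= PE1 (delta_mx 0 j); rewrite PE lfunE /= -rowE row1.
- by move=> x y; rewrite !PE /= mulP.
- by move=> x y; rewrite !PE /= evo_mulC mulP evo_mulC.
Qed.

(* [P] projects along the kernel of the functional [phi] onto the line spanned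
   by the annihilator element [e_j]. *)
Lemma decomposable_evo_ann (F : fieldType) d (s : seq 'rV[F]_d) (phi : 'cV[F]_d)
    (j : 'I_d) :
  (1 < d)%N -> s`_j = 0 -> phi j 0 != 0 ->
  (forall k : 'I_d, s`_k *m phi = 0) -> decomposable (evo d s).
Proof.
move=> d_gt1 sj phij sphi.
pose P : 'M[F]_d := (phi j 0)^-1 *: (phi *m delta_mx 0 j).
have evo_phi x y : evo_mul s x y *m phi = 0.
  by rewrite mulmx_suml big1 // => k _; rewrite -scalemxAl sphi scaler0.
have ejphi : (delta_mx 0 j : 'rV_d) *m phi = (phi j 0)%:M.
  by rewrite -rowE [LHS]mx11_scalar mxE.
have xP (x : 'rV_d) k : k != j -> (x *m P) 0 k = 0.
  move=> kj; rewrite -scalemxAr mulmxA [x *m phi]mx11_scalar mul_scalar_mx.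
  by rewrite !mxE (negPf kj) andbF !mulr0.
apply: (@decomposable_evo _ _ _ P).
- rewrite -scalemxAl -scalemxAr scalerA -mulmxA (mulmxA _ phi) ejphi.
  by rewrite mul_scalar_mx -scalemxAr scalerA divfK.
- move=> /matrixP/(_ j j); rewrite !mxE big_ord1 !mxE !eqxx mulr1 mulVf //.
  by move/eqP; rewrite oner_eq0.
- have [k kj] : exists k : 'I_d, k != j.
    apply/existsP; apply: contraLR d_gt1 => /existsPn allj; rewrite -leqNgt.
    rewrite -{1}[d]card_ord -(card1 j); apply/subset_leq_card/subsetP => k _.
    exact/negPn/allj.
  move=> P1; have := xP (delta_mx 0 k) k kj; rewrite P1 mulmx1 mxE !eqxx.
  by move/eqP; rewrite oner_eq0.
(* Both sides vanish: [phi] kills every product, and [x *m P] is a multiple of [e_j], whose square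
   is zero. *)
move=> x y; rewrite -scalemxAr mulmxA evo_phi mul0mx scaler0.
rewrite /evo_mul (bigD1 j) //= sj scaler0 add0r big1 // => k kj.
by rewrite xP // mul0r scale0r.
Qed.


Lemma evo_mulE (F : fieldType) d (s : seq 'rV[F]_d) x y k :
  evo_mul s x y 0 k = \sum_(j < d) x 0 j * y 0 j * s`_j 0 k.
Proof. by rewrite summxE; apply: eq_bigr => j _; rewrite mxE. Qed.

(** * Structure constants as lists *)

(* Structure constants are given by nested lists of scalars, on which sums
   over explicit ranges compute. *)
Definition evor (F : fieldType) d (S : seq (seq F)) : algebra F :=
  evo d [seq rowl d l | l <- S].

Notation "S `[ j , k ]" := (nth [::] S j)`_k (at level 3, format "S `[ j ,  k ]").

Lemma nth_rowl (F : fieldType) d (S : seq (seq F)) j (k : 'I_d) :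
  [seq rowl d l | l <- S]`_j 0 k = S`[j, k].
Proof.
have [ltjS | leSj] := ltnP j (size S); first by rewrite (nth_map [::]) // mxE.
by rewrite !nth_default ?size_map // mxE.
Qed.

Lemma evor_mulE (F : fieldType) d (S : seq (seq F)) (x y : 'rV[F]_d) k :
  evo_mul [seq rowl d l | l <- S] x y 0 k = \sum_(j < d) x 0 j * y 0 j * S`[j, k].
Proof. by rewrite summxE; apply: eq_bigr => j _; rewrite mxE nth_rowl. Qed.

(** Indexing by naturals, with default zero, lets vectors enter sums over explicit ranges. *)
Definition coords (F : fieldType) d (x : 'rV[F]_d) (j : nat) : F :=
  if insub j is Some k then x 0 k else 0.

Lemma coords_ord (F : fieldType) d (x : 'rV[F]_d) (k : 'I_d) : coords x k = x 0 k.
Proof. by rewrite /coords valK. Qed.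

Lemma mxl_mulE (F : fieldType) d (M N : seq (seq F)) (j k : 'I_d) :
  (mxl d M *m mxl d N) j k = \sum_(0 <= l < d) M`[j, l] * N`[l, k].
Proof. by rewrite big_mkord mxE; apply: eq_bigr => l _; rewrite !mxE. Qed.

Lemma row_mxlE (F : fieldType) d (M : seq (seq F)) (x : 'rV[F]_d) (k : 'I_d) :
  (x *m mxl d M) 0 k = \sum_(0 <= l < d) coords x l * M`[l, k].
Proof.
by rewrite big_mkord mxE; apply: eq_bigr => l _; rewrite coords_ord mxE.
Qed.

(** Vectors are replaced by arbitrary functions on naturals: once the big operators are unlocked at
    a concrete [d], the hypotheses become rational identities that [field] decides. *)
Lemma isomorphic_evor (F : fieldType) d (M N S S' : seq (seq F)) :
  (forall j k, (j < d)%N -> (k < d)%N ->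
    \sum_(0 <= l < d) M`[j, l] * N`[l, k] = (j == k)%:R) ->
  (forall (x y : nat -> F) k, (k < d)%N ->
    \sum_(0 <= j < d) (\sum_(0 <= l < d) x l * y l * S'`[l, j]) * M`[j, k] =
    \sum_(0 <= j < d) (\sum_(0 <= l < d) x l * M`[l, j]) *
                      (\sum_(0 <= l < d) y l * M`[l, j]) * S`[j, k]) ->
  isomorphic (evor d S) (evor d S').
Proof.
move=> MN1 mulM; apply: (@isomorphic_evo _ _ _ _ (mxl d M) (mxl d N)).
  by apply/matrixP => j k; rewrite mxl_mulE MN1 // !mxE.
move=> x y; apply/rowP => k; rewrite row_mxlE evor_mulE.
transitivity (\sum_(0 <= j < d)
    (\sum_(0 <= l < d) coords x l * coords y l * S'`[l, j]) * M`[j, k]).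
  rewrite !big_mkord; apply: eq_bigr => j _; rewrite coords_ord evor_mulE big_mkord.
  by under [in RHS]eq_bigr do rewrite !coords_ord.
by rewrite mulM // big_mkord; apply: eq_bigr => j _; rewrite !row_mxlE.
Qed.

Lemma decomposable_evor (F : fieldType) d (P S : seq (seq F)) :
  (forall j k, (j < d)%N -> (k < d)%N ->
    \sum_(0 <= l < d) P`[j, l] * P`[l, k] = P`[j, k]) ->
  (exists2 j, (j < d)%N & exists2 k, (k < d)%N & P`[j, k] != 0) ->
  (exists2 j, (j < d)%N & exists2 k, (k < d)%N & P`[j, k] != (j == k)%:R) ->
  (forall (x y : nat -> F) k, (k < d)%N ->
    \sum_(0 <= j < d) (\sum_(0 <= l < d) x l * y l * S`[l, j]) * P`[j, k] =
    \sum_(0 <= j < d) (\sum_(0 <= l < d) x l * P`[l, j]) * y j * S`[j, k]) ->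
  decomposable (evor d S).
Proof.
move=> PP [j jd [k kd P0]] [j1 j1d [k1 k1d P1]] mulP.
apply: (@decomposable_evo _ _ _ (mxl d P)).
- by apply/matrixP => ? ?; rewrite mxl_mulE PP // !mxE.
- by move/matrixP/(_ (Ordinal jd) (Ordinal kd)); rewrite !mxE; apply/eqP.
- by move/matrixP/(_ (Ordinal j1d) (Ordinal k1d)); rewrite !mxE; apply/eqP.
move=> x y; apply/rowP => l; rewrite row_mxlE evor_mulE.
transitivity (\sum_(0 <= j < d)
    (\sum_(0 <= l < d) coords x l * coords y l * S`[l, j]) * P`[j, l]).
  rewrite !big_mkord; apply: eq_bigr => m _; rewrite coords_ord evor_mulE big_mkord.
  by under [in RHS]eq_bigr do rewrite !coords_ord.
by rewrite mulP // big_mkord; apply: eq_bigr => m _; rewrite !row_mxlE coords_ord.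
Qed.

Lemma decomposable_evor_ann (F : fieldType) d (S : seq (seq F)) (phi : seq F) j :
  (1 < d)%N -> (j < d)%N -> (forall k, (k < d)%N -> S`[j, k] = 0) -> phi`_j != 0 ->
  (forall k, (k < d)%N -> \sum_(0 <= l < d) S`[k, l] * phi`_l = 0) ->
  decomposable (evor d S).
Proof.
move=> d_gt1 ltjd Sj phij Sphi.
apply: (@decomposable_evo_ann _ _ _ (\col_l phi`_l) (Ordinal ltjd)) => //.
- by apply/rowP => k; rewrite nth_rowl Sj // mxE.
- by rewrite mxE.
move=> k; apply/colP => l; rewrite ord1 !mxE -[RHS](Sphi k) // big_mkord.
by apply: eq_bigr => m _; rewrite nth_rowl mxE.
Qed.

Definition label_dim (l : label) : nat :=
  match l with
  | L1 => 1
  | L1_1 => 2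
  | L1_2 | L1_1_1 => 3
  | _ => 4
  end.

Definition label_rows (F : fieldType) (i : F) (l : label) : seq (seq F) :=
  match l with
  | L1        => [::]
  | L1_1      => [:: [:: 0; 1]]
  | L1_2      => [:: [:: 0; 0; 1]; [:: 0; 0; 1]]
  | L1_1_1    => [:: [:: 0; 1; 0]; [:: 0; 0; 1]]
  | L1_3      => [:: [:: 0; 0; 0; 1]; [:: 0; 0; 0; 1]; [:: 0; 0; 0; 1]]
  | L1_2_1    => [:: [:: 0; 1; 0; 0]; [:: 0; 0; 0; 1]; [:: 0; 0; 0; 1]]
  | L1_2_1'   => [:: [:: 0; 1; i; 0]; [:: 0; 0; 0; 1]; [:: 0; 0; 0; 1]]
  | L1_1_2    => [:: [:: 0; 0; 1; 0]; [:: 0; 0; 1; 0]; [:: 0; 0; 0; 1]]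
  | L1_1_2'   => [:: [:: 0; 0; 1; 0]; [:: 0; 0; 1; 1]; [:: 0; 0; 0; 1]]
  | L1_1_1_1  => [:: [:: 0; 1; 0; 0]; [:: 0; 0; 1; 0]; [:: 0; 0; 0; 1]]
  | L1_1_1_1' => [:: [:: 0; 1; 1; 0]; [:: 0; 0; 1; 0]; [:: 0; 0; 0; 1]]
  end.

Lemma label_algebraE (F : fieldType) (i : F) l :
  label_algebra i l = evor (label_dim l) (label_rows i l).
Proof.
case: l; rewrite /evor //=; congr evo; repeat congr cons.
all: apply/rowP; case=> [[|[|[|[|//]]]] ltkd] //; rewrite !mxE /=.
all: by rewrite ?mulr0 ?mulr1 ?addr0 ?add0r.
Qed.

(** * Classification *)

Lemma sqrt_closed (F : closedFieldType) (x : F) : exists y, x = y ^+ 2.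
Proof.
have [y] := @solve_monicpoly F 2 (fun j => if j is 0 then x else 0) isT.
by rewrite !big_ord_recl big_ord0 /= mulr1 mul0r !addr0 => <-; exists y.
Qed.

Ltac case_ord := case=> [|[|[|[|//]]]] //.

Ltac neq0_field := do ?[apply/andP; split]; rewrite ?mulf_neq0 ?expf_neq0 //.

(* [M] lists the new natural basis in terms of the old one, [N] the old one in
   terms of the new one. *)
Ltac evor_iso M N :=
  apply: (@isomorphic_evor _ _ M N);
  repeat match goal with x := _ |- _ => subst x end;
  [ case_ord; case_ord=> _ _; rewrite unlock /=; field; neq0_field
  | move=> ? ?; case_ord=> _; rewrite unlock /=; field; neq0_field ].

Section Classification.
Variables (F : closedFieldType) (i : F).
Hypothesis i2 : i ^+ 2 = -1.
Implicit Types a b c p q r : F.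

Definition upper4 a b c p q r : algebra F :=
  evor 4 [:: [:: 0; a; b; c]; [:: 0; 0; p; q]; [:: 0; 0; 0; r]].

(** Here [e_1] is in the annihilator and occurs in no square, so it spans a direct summand. *)
Lemma upper4_ann1 p q r : decomposable (upper4 0 0 0 p q r).
Proof.
apply: (@decomposable_evor_ann _ _ _ [:: 1] 0) => //=; rewrite ?oner_eq0 //.
  by case_ord.
by case_ord=> _; rewrite unlock /=; ring.
Qed.

(** [P] projects onto the span of [e_1] and [e_1^2] along the span of [e_3] and [e_4]. *)
Lemma upper4_split13 a c r : a != 0 -> decomposable (upper4 a 0 c 0 0 r).
Proof.
move=> a0; pose P := [:: [:: 1; 0; 0; 0]; [:: 0; 1; 0; c / a]].
apply: (@decomposable_evor _ _ P) => [||| x y]; last first.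
- by case_ord=> _; rewrite unlock /=; field.
- by exists 2%N => //; exists 2%N; rewrite //= eq_sym oner_eq0.
- by exists 0%N => //; exists 0%N; rewrite //= oner_eq0.
- by case_ord; case_ord=> _ _; rewrite unlock /=; field.
Qed.

(** The determinant makes [e_1^2] and [e_2^2] a basis of the span of [e_3] and [e_4]; [P] projects
    onto the span of [e_1, e_1^2] along that of [e_2, e_2^2]. *)
Lemma upper4_split12 b c p q : b * q - c * p != 0 -> decomposable (upper4 0 b c p q 0).
Proof.
move=> D0; pose D := b * q - c * p.
pose P := [:: [:: 1; 0; 0; 0]; [::]; [:: 0; 0; b * q / D; c * q / D];
  [:: 0; 0; - (p * b) / D; - (p * c) / D]].
apply: (@decomposable_evor _ _ P) => [||| x y]; last first.
- by case_ord=> _; rewrite unlock /= /D; field.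
- by exists 1%N => //; exists 1%N; rewrite //= eq_sym oner_eq0.
- by exists 0%N => //; exists 0%N; rewrite //= oner_eq0.
- by case_ord; case_ord=> _ _; rewrite unlock /= /D; field.
Qed.

(** Both [e_3] and [e_4] are annihilator elements, so one of them splits off as soon as a functional
    [(0, w, u, v)] with [u] or [v] nonzero kills [e_1^2] and [e_2^2]. Such a functional exists
    except when [a = 0] and the determinant [b q - c p] is nonzero, which is the case of
    [upper4_split12]. *)
Lemma upper4_dim_ann2 a b c p q : decomposable (upper4 a b c p q 0).
Proof.
have ker1 (y z : F) : exists u v, y * u + z * v = 0 /\ (u != 0) || (v != 0).
  have [-> | y0] := eqVneq y 0; last by exists (- z), y; split; [ring | rewrite y0 orbT].
  have [-> | z0] := eqVneq z 0; first by exists 1, 0; rewrite oner_eq0; split; first ring.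
  by exists z, 0; split; [ring | rewrite z0].
suff [// | [u [v [w [uv0 row1 row2]]]]] : decomposable (upper4 a b c p q 0) \/
    exists u v w, [/\ (u != 0) || (v != 0), a * w + b * u + c * v = 0 & p * u + q * v = 0].
  by case/orP: uv0 => phi0;
    [apply: (@decomposable_evor_ann _ _ _ [:: 0; w; u; v] 2)
    |apply: (@decomposable_evor_ann _ _ _ [:: 0; w; u; v] 3)] => //;
    case_ord=> // _; rewrite unlock /=;
    by [ring | rewrite -[RHS]row1; ring | rewrite -[RHS]row2; ring].
have [a0 | a0] := eqVneq a 0; last first.
  have [u [v [uvP uv0]]] := ker1 p q; right.
  by exists u, v, (- (b * u + c * v) / a); split=> //; field.
rewrite a0; have [D0 | D0] := eqVneq (b * q - c * p) 0; last first.
  by left; apply: upper4_split12.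
(* The rows [(b, c)] and [(p, q)] are dependent: if the second is nonzero, [(q, -p)] is orthogonal
   to both. *)
right; have [p0 | p0] := eqVneq p 0; last first.
  by exists q, (- p), 0; split; [rewrite oppr_eq0 p0 orbT | rewrite -[RHS]D0; ring | ring].
have [q0 | q0] := eqVneq q 0; last first.
  by exists q, (- p), 0; split; [rewrite q0 | rewrite -[RHS]D0; ring | ring].
have [u [v [uvP uv0]]] := ker1 b c.
by exists u, v, 0; split=> //; [rewrite -[RHS]uvP | rewrite p0 q0]; ring.
Qed.

(** The annihilator element [e_2] splits off: the functional vanishes on [e_1^2], also for [a = 0],
    where [- a / b] is zero whatever [b] is. *)
Lemma upper4_ann2 a b c r : (a == 0) || (b != 0) -> decomposable (upper4 a b c 0 0 r).
Proof.
move=> ab; apply: (@decomposable_evor_ann _ _ _ [:: 0; 1; - a / b] 1); rewrite //= ?oner_eq0 //.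
  by case_ord.
case/orP: ab => [/eqP-> | b0]; case_ord=> _; rewrite unlock /=; by [ring | field].
Qed.

(** The new basis consists of [e_1] and its iterated squares, which are orthogonal because
    [b = 0]. *)
Lemma upper4_L1_1_1_1 a b c p q r : a != 0 -> p != 0 -> r != 0 ->
  b = 0 -> isomorphic (upper4 a b c p q r) (label_algebra i L1_1_1_1).
Proof.
move=> a0 p0 r0 ->; rewrite label_algebraE; 
evor_iso [:: [:: 1; 0; 0; 0]; [:: 0; a; 0; c]; [:: 0; 0; a ^+ 2 * p; a ^+ 2 * q];
             [:: 0; 0; 0; a ^+ 4 * p ^+ 2 * r]]
  [:: [:: 1; 0; 0; 0]; [:: 0; a^-1; 0; - c / a / (a ^+ 4 * p ^+ 2 * r)];
      [:: 0; 0; (a ^+ 2 * p)^-1; - q / p / (a ^+ 4 * p ^+ 2 * r)];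
      [:: 0; 0; 0; (a ^+ 4 * p ^+ 2 * r)^-1]].
Qed.

(** With [f_1 = t e_1], [f_2 = l e_2 + m e_4], [f_3 = f_2^2] and [f_4 = f_3^2], the equation
    [f_1^2 = f_2 + f_3] forces [l], [m] and [t^2 = b / (a^2 p)]. *)
Lemma upper4_L1_1_1_1' a b c p q r : a != 0 -> p != 0 -> r != 0 ->
  b != 0 -> isomorphic (upper4 a b c p q r) (label_algebra i L1_1_1_1').
Proof.
move=> a0 p0 r0 b0; rewrite label_algebraE.
have [t tE] := sqrt_closed (b / (a ^+ 2 * p)).
have t0 : t != 0.
  by rewrite -sqrf_eq0 -tE mulf_neq0 ?invr_neq0 ?mulf_neq0 ?expf_neq0.
have -> : b = t ^+ 2 * a ^+ 2 * p.
  by rewrite -tE; field; rewrite a0 p0.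
pose l := t ^+ 2 * a; pose m := t ^+ 2 * c - l ^+ 2 * q.
pose n := l ^+ 4 * p ^+ 2 * r.
evor_iso [:: [:: t; 0; 0; 0]; [:: 0; l; 0; m]; [:: 0; 0; l ^+ 2 * p; l ^+ 2 * q];
             [:: 0; 0; 0; n]]
  [:: [:: t^-1; 0; 0; 0]; [:: 0; l^-1; 0; - m / l / n];
      [:: 0; 0; (l ^+ 2 * p)^-1; - q / p / n]; [:: 0; 0; 0; n^-1]].
Qed.

(** The chain starts at [e_2]; [e_1] is rescaled so that its square equals that of [e_2^2]. *)
Lemma upper4_L1_2_1_perm c p q r : c != 0 -> p != 0 -> r != 0 ->
  isomorphic (upper4 0 0 c p q r) (label_algebra i L1_2_1).
Proof.
move=> c0 p0 r0; rewrite label_algebraE.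
have [w wE] := sqrt_closed (c / r).
have w0 : w != 0 by rewrite -sqrf_eq0 -wE mulf_neq0 ?invr_neq0.
have -> : c = w ^+ 2 * r by rewrite -wE divfK.
evor_iso [:: [:: 0; 1; 0; 0]; [:: 0; 0; p; q]; [:: p / w; 0; 0; 0];
             [:: 0; 0; 0; p ^+ 2 * r]]
  [:: [:: 0; 0; w / p; 0]; [:: 1; 0; 0; 0];
      [:: 0; p^-1; 0; - q / (p ^+ 3 * r)]; [:: 0; 0; 0; (p ^+ 2 * r)^-1]].
Qed.

(** The factor [w] makes the [e_3]-components of [(w e_1)^2] and [e_2^2] agree. Their difference is
    then [x^2] times [(e_2^2)^2]: for [x = 0] the squares coincide, and otherwise scaling both
    vectors by [x] makes the difference exactly the new [e_4]. *)
Lemma upper4_L1_1_2 b c p q r : b != 0 -> p != 0 -> r != 0 ->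
  exists l, isomorphic (upper4 0 b c p q r) (label_algebra i l).
Proof.
move=> b0 p0 r0; have [w wE] := sqrt_closed (p / b).
have w0 : w != 0 by rewrite -sqrf_eq0 -wE mulf_neq0 ?invr_neq0.
have {wE} pE : p = b * w ^+ 2 by rewrite -wE; field.
have [x xE] := sqrt_closed ((c * w ^+ 2 - q) / (p ^+ 2 * r)).
have {xE} qE : q = c * w ^+ 2 - x ^+ 2 * p ^+ 2 * r by rewrite -xE; field; rewrite r0.
move: p0; rewrite {}qE {}pE => p0; have [-> | x0] := eqVneq x 0.
  exists L1_1_2; rewrite label_algebraE; pose n := b ^+ 2 * w ^+ 4 * r.
  evor_iso [:: [:: 0; 1; 0; 0]; [:: w; 0; 0; 0]; [:: 0; 0; b * w ^+ 2; c * w ^+ 2];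
               [:: 0; 0; 0; n]]
    [:: [:: 0; w^-1; 0; 0]; [:: 1; 0; 0; 0];
        [:: 0; 0; (b * w ^+ 2)^-1; - c / b / n]; [:: 0; 0; 0; n^-1]].
exists L1_1_2'; rewrite label_algebraE; pose n := x ^+ 4 * b ^+ 2 * w ^+ 4 * r.
pose q' := c * w ^+ 2 - x ^+ 2 * (b * w ^+ 2) ^+ 2 * r.
evor_iso [:: [:: 0; x; 0; 0]; [:: x * w; 0; 0; 0];
             [:: 0; 0; x ^+ 2 * b * w ^+ 2; x ^+ 2 * q']; [:: 0; 0; 0; n]]
  [:: [:: 0; (x * w)^-1; 0; 0]; [:: x^-1; 0; 0; 0];
      [:: 0; 0; (x ^+ 2 * b * w ^+ 2)^-1; - q' / (b * w ^+ 2) / n]; [:: 0; 0; 0; n^-1]].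
Qed.

Lemma upper4_L1_3 c q r : c != 0 -> q != 0 -> r != 0 ->
  isomorphic (upper4 0 0 c 0 q r) (label_algebra i L1_3).
Proof.
move=> c0 q0 r0; rewrite label_algebraE.
have [w wE] := sqrt_closed (c / r); have [z zE] := sqrt_closed (q / r).
have w0 : w != 0 by rewrite -sqrf_eq0 -wE mulf_neq0 ?invr_neq0.
have z0 : z != 0 by rewrite -sqrf_eq0 -zE mulf_neq0 ?invr_neq0.
have -> : c = w ^+ 2 * r by rewrite -wE divfK.
have -> : q = z ^+ 2 * r by rewrite -zE divfK.
evor_iso [:: [:: w^-1; 0; 0; 0]; [:: 0; z^-1; 0; 0]; [:: 0; 0; 1; 0]; [:: 0; 0; 0; r]]
  [:: [:: w; 0; 0; 0]; [:: 0; z; 0; 0]; [:: 0; 0; 1; 0]; [:: 0; 0; 0; r^-1]].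
Qed.

(* [e_2 / z] and [e_3] have the same square, so the orthogonal group of
   [x^2 + y^2] acts on the component [A e_2 / z + b e_3] of [e_1^2], with
   [A = a z]; its orbits depend on whether that vector is isotropic. *)
Lemma upper4_L1_2_1 a b c q r : (a != 0) || (b != 0) -> q != 0 -> r != 0 ->
  exists l, isomorphic (upper4 a b c 0 q r) (label_algebra i l).
Proof.
move=> ab0 q0 r0; have [z zE] := sqrt_closed (q / r).
have z0 : z != 0 by rewrite -sqrf_eq0 -zE mulf_neq0 ?invr_neq0.
have {zE} -> : q = z ^+ 2 * r by rewrite -zE divfK.
pose A := a * z; have aE : a = A / z by rewrite mulfK.
have {ab0} Ab0 : (A != 0) || (b != 0) by rewrite mulf_eq0 negb_or z0 andbT.
move: A aE Ab0 => A -> Ab0 {q q0 a}.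
have [D0 | D0] := eqVneq (A ^+ 2 + b ^+ 2) 0; last first.
  (* In the anisotropic case [e_1^2] is itself a basis vector, completed by an orthogonal vector
     with the same square [D r e_4]. *)
  exists L1_2_1; rewrite label_algebraE; pose D := A ^+ 2 + b ^+ 2.
  evor_iso [:: [:: 1; 0; 0; 0]; [:: 0; A / z; b; c]; [:: 0; - b / z; A; 0];
               [:: 0; 0; 0; D * r]]
    [:: [:: 1; 0; 0; 0]; [:: 0; z * A / D; - z * b / D; - z * A * c / D / (D * r)];
        [:: 0; b / D; A / D; - b * c / D / (D * r)]; [:: 0; 0; 0; (D * r)^-1]].
have p0 : (b - i * A) * (b + i * A) = 0.
  rewrite -[RHS]D0; transitivity (b ^+ 2 - i ^+ 2 * A ^+ 2); first by ring.
  by rewrite i2; ring.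
exists L1_2_1'; rewrite label_algebraE; pose n := A ^+ 2 * r.
have A0 : A != 0.
  apply: contraTneq Ab0 => A0; move: D0; rewrite A0 expr0n add0r => /eqP.
  by rewrite sqrf_eq0 negb_or !negbK eqxx.
(* An isotropic vector has [b] equal to [i A] or [- i A]; the sign is absorbed into the new
   [e_3]. *)
move/eqP: p0; rewrite mulf_eq0 subr_eq0 addr_eq0 => /orP[] /eqP->.
  evor_iso [:: [:: 1; 0; 0; 0]; [:: 0; A / z; 0; c]; [:: 0; 0; A; 0]; [:: 0; 0; 0; n]]
    [:: [:: 1; 0; 0; 0]; [:: 0; z / A; 0; - z * c / A / n]; [:: 0; 0; A^-1; 0];
        [:: 0; 0; 0; n^-1]].
evor_iso [:: [:: 1; 0; 0; 0]; [:: 0; A / z; 0; c]; [:: 0; 0; - A; 0]; [:: 0; 0; 0; n]]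
  [:: [:: 1; 0; 0; 0]; [:: 0; z / A; 0; - z * c / A / n]; [:: 0; 0; - A^-1; 0];
      [:: 0; 0; 0; n^-1]].
Qed.


(** For [r] and [p] nonzero, the first nonzero entry among [a], [b], [c] gives type [[1,1,1,1]],
    [[1,1,2]] or [[1,2,1]]. For [p = 0] and [q], [r] nonzero, the type is [[1,2,1]] if [a] or [b] is
    nonzero and [[1,3]] if only [c] is. The rest decomposes. *)
Lemma upper4_classification a b c p q r :
  decomposable (upper4 a b c p q r) \/
  exists l, isomorphic (upper4 a b c p q r) (label_algebra i l).
Proof.
have [-> | r0] := eqVneq r 0; first by left; apply: upper4_dim_ann2.
have [-> | p0] := eqVneq p 0; last first.
  have [-> | a0] := eqVneq a 0; last first.
    right; have [b0 | b0] := eqVneq b 0.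
      by exists L1_1_1_1; apply: upper4_L1_1_1_1.
    by exists L1_1_1_1'; apply: upper4_L1_1_1_1'.
  have [-> | b0] := eqVneq b 0; last by right; apply: upper4_L1_1_2.
  have [-> | c0] := eqVneq c 0; first by left; apply: upper4_ann1.
  by right; exists L1_2_1; apply: upper4_L1_2_1_perm.
have [-> | q0] := eqVneq q 0.
  left; have [ab | ] := boolP ((a == 0) || (b != 0)); first exact: upper4_ann2.
  by rewrite negb_or negbK => /andP[a0 /eqP->]; apply: upper4_split13.
have [ab0 | ] := boolP ((a != 0) || (b != 0)); first by right; apply: upper4_L1_2_1.
rewrite negb_or !negbK => /andP[/eqP-> /eqP->].
have [-> | c0] := eqVneq c 0; first by left; apply: upper4_ann1.
by right; exists L1_3; apply: upper4_L1_3.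
Qed.

Lemma upper3_classification a b c (A := evor 3 [:: [:: 0; a; b]; [:: 0; 0; c]]) :
  decomposable A \/ exists l, isomorphic A (label_algebra i l).
Proof.
rewrite {}/A; have [-> | c0] := eqVneq c 0.
  left; have [-> | a0] := eqVneq a 0.
    apply: (@decomposable_evor_ann _ _ _ [:: 0; 1] 1) => //=; rewrite ?oner_eq0 //.
      by case_ord.
    by case_ord=> _; rewrite unlock /=; ring.
  apply: (@decomposable_evor_ann _ _ _ [:: 0; - b / a; 1] 2) => //=; rewrite ?oner_eq0 //.
    by case_ord.
  by case_ord=> _; rewrite unlock /=; field.
have [-> | a0] := eqVneq a 0; last first.
  right; exists L1_1_1; rewrite label_algebraE.
  evor_iso [:: [:: 1; 0; 0]; [:: 0; a; b]; [:: 0; 0; a ^+ 2 * c]]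
    [:: [:: 1; 0; 0]; [:: 0; a^-1; - b / a / (a ^+ 2 * c)]; [:: 0; 0; (a ^+ 2 * c)^-1]].
have [-> | b0] := eqVneq b 0.
  left; apply: (@decomposable_evor_ann _ _ _ [:: 1] 0) => //=; rewrite ?oner_eq0 //.
    by case_ord.
  by case_ord=> _; rewrite unlock /=; ring.
right; exists L1_2; rewrite label_algebraE; have [w wE] := sqrt_closed (b / c).
have w0 : w != 0 by rewrite -sqrf_eq0 -wE mulf_neq0 ?invr_neq0.
have -> : b = w ^+ 2 * c by rewrite -wE divfK.
evor_iso [:: [:: w^-1; 0; 0]; [:: 0; 1; 0]; [:: 0; 0; c]]
  [:: [:: w; 0; 0]; [:: 0; 1; 0]; [:: 0; 0; c^-1]].
Qed.

Lemma upper2_classification a (A := evor 2 [:: [:: 0; a]]) :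
  decomposable A \/ exists l, isomorphic A (label_algebra i l).
Proof.
rewrite {}/A; have [-> | a0] := eqVneq a 0.
  left; apply: (@decomposable_evor_ann _ _ _ [:: 1] 0) => //=; rewrite ?oner_eq0 //.
    by case_ord.
  by case_ord=> _; rewrite unlock /=; ring.
right; exists L1_1; rewrite label_algebraE.
evor_iso [:: [:: 1; 0]; [:: 0; a]] [:: [:: 1; 0]; [:: 0; a^-1]].
Qed.

Lemma evo_classification d (s : seq 'rV[F]_d) : (0 < d <= 4)%N ->
  (forall j k : 'I_d, (k <= j)%N -> s`_j 0 k = 0) ->
  decomposable (evo d s) \/ exists l, isomorphic (evo d s) (label_algebra i l).
Proof.
move=> d4 upper_s; pose S j k := coords s`_j k.
have S0 j k : (k <= j < d)%N -> S j k = 0.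
  case/andP=> lekj ltjd; have ltkd := leq_ltn_trans lekj ltjd.
  by rewrite /S (coords_ord _ (Ordinal ltkd)) (upper_s (Ordinal ltjd)).
(* Each matrix is written out as an explicit nested list, dimension by dimension. *)
suff [T ST clT] : exists2 T, forall j k, (j < d)%N -> (k < d)%N -> S j k = T`[j, k]
    & decomposable (evor d T) \/ exists l, isomorphic (evor d T) (label_algebra i l).
  have iso : isomorphic (evo d s) (evor d T).
    apply: isomorphic_evo_eq => j ltjd; apply/rowP => k.
    by rewrite nth_rowl -ST // -coords_ord.
  case: clT => [dec | [l isol]]; [left | right].
    exact: decomposable_iso (isomorphic_sym iso) dec.
  by exists l; apply: isomorphic_trans iso isol.
case: d d4 s upper_s @S S0 => [|[|[|[|[|//]]]]] // _ s upper_s S S0.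
- exists [::]; first by do 2![case=> //] => _ _; rewrite S0.
  right; exists L1; rewrite label_algebraE.
  evor_iso ([:: [:: 1]] : seq (seq F)) ([:: [:: 1]] : seq (seq F)).
- exists [:: [:: 0; S 0 1]]; last exact: upper2_classification.
  do 2![case=> [|[|//]]] => _ _ /=; by [|rewrite S0].
- exists [:: [:: 0; S 0 1; S 0 2]; [:: 0; 0; S 1 2]]; last exact: upper3_classification.
  do 2![case=> [|[|[|//]]]] => _ _ /=; by [|rewrite S0].
exists [:: [:: 0; S 0 1; S 0 2; S 0 3]; [:: 0; 0; S 1 2; S 1 3]; [:: 0; 0; 0; S 2 3]].
  do 2!case_ord; move=> _ _ /=; by [|rewrite S0].
exact: upper4_classification.
Qed.

End Classification.

(** * Types *)

Section Tail.
Variables (F : fieldType) (d : nat).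

Let delta : d.-tuple 'rV[F]_d := [tuple delta_mx 0 k | k < d].

Let nth_delta (k : 'I_d) : delta`_k = delta_mx 0 k.
Proof. by rewrite -tnth_nth tnth_mktuple. Qed.

(** Every term of the annihilator series of a listed algebra is such a coordinate subspace. *)
Definition tailv m : {vspace 'rV[F]_d} := <<drop m delta>>%VS.

Lemma mem_tailv m x : x \in tailv m <-> forall k : 'I_d, (k < m)%N -> x 0 k = 0.
Proof.
split=> [/(@coord_span _ _ _ (in_tuple _))-> k ltkm | x0].
  rewrite summxE big1 // => j _.
  have ltjd : (m + j < d)%N.
    by rewrite -ltn_subRL -[X in (X - _)%N](size_tuple delta) -size_drop ltn_ord.
  rewrite mxE nth_drop (nth_delta (Ordinal ltjd)) mxE.
  suff /negPf-> : k != Ordinal ltjd by rewrite andbF mulr0.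
  by rewrite neq_ltn /= ltn_addr.
rewrite [x]row_sum_delta memv_suml // => k _.
have [ltkm | lemk] := ltnP k m; first by rewrite x0 // scale0r mem0v.
rewrite memvZ // memv_span // -nth_delta -(subnKC lemk) -nth_drop mem_nth //.
by rewrite size_drop size_tuple ltn_sub2r // (leq_ltn_trans lemk).
Qed.

Lemma dim_tailv m : \dim (tailv m) = (d - m)%N.
Proof.
suff: free (drop m delta) by move/eqP->; rewrite size_drop size_tuple.
suff: free delta by rewrite -{1}[tval delta](cat_take_drop m) cat_free => /and3P[].
apply/freeP => c /rowP c0 k; have:= c0 k; rewrite summxE (bigD1 k) //= big1.
  by rewrite nth_delta !mxE !eqxx mulr1 addr0.
by move=> j jk; rewrite nth_delta !mxE eq_sym (negPf jk) mulr0.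
Qed.

Lemma tailv0 : tailv 0 = fullv.
Proof. by apply/eqP; rewrite eqEdim subvf dim_tailv subn0 dimvf /dim /= mul1n. Qed.

Lemma tailv_full : tailv d = 0%VS.
Proof. by apply/eqP; rewrite -dimv_eq0 dim_tailv subnn. Qed.

(** Multiplying [x] by [e_j] gives [x_j e_j^2], so [x] annihilates modulo [tailv m] exactly when
    each basis vector in its support has its square there; by hypothesis these are the vectors of
    index at least [n]. *)
Lemma ann_mod_tailv (S : seq (seq F)) m n :
  (forall j, (j < d)%N -> (n <= j)%N = all (fun k => S`[j, k] == 0) (iota 0 m)) ->
  (m <= d)%N -> ann_mod (A := evor d S) (tailv m) = tailv n.
Proof.
move=> Snm ltmd; apply/vspaceP => x; apply/idP/idP.
  move=> /mem_ann_mod xV; apply/mem_tailv => j ltjn; apply/eqP.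
  apply: contraLR ltjn => xj; rewrite -leqNgt Snm //; apply/allP => k.
  rewrite mem_iota => /= ltkm; have ltkd := leq_trans ltkm ltmd.
  have /mem_tailv/(_ (Ordinal ltkd) ltkm) := (xV (delta_mx 0 j)).1.
  rewrite evor_mulE (bigD1 j) //= big1 => [|l lj]; last first.
    by rewrite mxE (negPf lj) andbF mulr0 mul0r.
  by rewrite mxE !eqxx mulr1 addr0 => /eqP; rewrite mulf_eq0 (negPf xj).
move=> /mem_tailv x0; apply/mem_ann_mod => y.
suff xyV (u v : 'rV_d) : (forall j : 'I_d, (j < n)%N -> u 0 j * v 0 j = 0) ->
    evo_mul [seq rowl d l | l <- S] u v \in tailv m.
  by split; apply: xyV => j ltjn; rewrite x0 ?mul0r ?mulr0.
move=> uv0; apply/mem_tailv => k ltkm; rewrite evor_mulE big1 // => j _.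
have [ltjn | lenj] := ltnP j n; first by rewrite uv0 // mul0r.
move: lenj; rewrite Snm // => /allP/(_ k); rewrite mem_iota => /(_ ltkm)/eqP->.
by rewrite mulr0.
Qed.

(** This reduces the type to a finite test on matrix entries, [m r] being the codimension of the
    [r]-th annihilator. Positive entries of [t] make the series strictly increasing, hence its
    length minimal. *)
Lemma has_type_evor (S : seq (seq F)) (t : seq nat)
    (m := fun r => (d - sumn (take r t))%N) :
  all (ltn 0) t -> sumn t = d ->
  (forall r, (r < size t)%N -> forall j, (j < d)%N ->
    (m r.+1 <= j)%N = all (fun k => S`[j, k] == 0) (iota 0 (m r))) ->
  has_type (evor d S) t.
Proof.
move=> t_gt0 sum_t Sm.
have sum_take r : (r < size t)%N ->
    (sumn (take r.+1 t) = sumn (take r t) + nth 0 t r)%N.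
  by move=> ltrt; rewrite (take_nth 0%N) // sumn_rcons.
have le_take r : (sumn (take r t) <= d)%N.
  by rewrite -[d]sum_t -{2}[t](cat_take_drop r) sumn_cat leq_addr.
have annE r : (r <= size t)%N -> ann (evor d S) r = tailv (m r).
  elim: r => [_ | r IHr ltrt]; first by rewrite /m take0 subn0 tailv_full.
  rewrite [LHS]/= -/(ann _ r) IHr 1?ltnW //.
  by apply: ann_mod_tailv; rewrite ?leq_subr //; apply: Sm.
have dim_ann r : (r <= size t)%N -> \dim (ann (evor d S) r) = sumn (take r t).
  by move=> lert; rewrite annE // dim_tailv subKn.
split.
- by rewrite annE // /m take_size sum_t subnn tailv0.
- move=> r ltrt annT; have := dim_ann r (ltnW ltrt).
  rewrite annT -tailv0 dim_tailv subn0 -[d]sum_t -{1}[t](cat_take_drop r) sumn_cat.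
  rewrite (drop_nth 0%N) //= => /eqP; rewrite -[X in _ == X]addn0 eqn_add2l addn_eq0.
  have tr_gt0 : (0 < nth 0%N t r)%N by apply: (allP t_gt0); rewrite mem_nth.
  by rewrite eqn0Ngt tr_gt0.
move=> r ltrt.
by rewrite (dim_ann r.+1) // (dim_ann r (ltnW ltrt)) sum_take // addKn.
Qed.

End Tail.

Lemma has_type_label (F : fieldType) (i : F) l :
  has_type (label_algebra i l) (label_type l).
Proof.
rewrite label_algebraE; case: l; apply: has_type_evor => //.
all: case_ord=> _; case_ord=> _; by rewrite /= ?eqxx ?oner_eq0 ?andbF.
Qed.

Lemma coords_evo_mul (F : fieldType) d (s : seq 'rV[F]_d) (x y : 'rV[F]_d) k :
  (k < d)%N -> coords (amul (evo d s) x y) k =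
    \sum_(0 <= j < d) coords x j * coords y j * coords s`_j k.
Proof.
move=> ltkd; rewrite (coords_ord _ (Ordinal ltkd)) evo_mulE big_mkord.
by apply: eq_bigr => j _; rewrite !coords_ord (coords_ord _ (Ordinal ltkd)).
Qed.

Lemma coords_e (F : fieldType) d j k :
  (k < d)%N -> coords (e j : 'rV[F]_d) k = (k.+1 == j)%:R.
Proof. by move=> ltkd; rewrite (coords_ord _ (Ordinal ltkd)) mxE. Qed.

Lemma coords0 (F : fieldType) d k : coords (0 : 'rV[F]_d) k = 0.
Proof. by rewrite /coords; case: insubP => // j _ _; rewrite mxE. Qed.

Lemma coordsD (F : fieldType) d (x y : 'rV[F]_d) k :
  coords (x + y) k = coords x k + coords y k.
Proof. by rewrite /coords; case: insubP => [j _ _|]; rewrite ?mxE ?addr0. Qed.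

Lemma coordsZ (F : fieldType) d a (x : 'rV[F]_d) k :
  coords (a *: x) k = a * coords x k.
Proof. by rewrite /coords; case: insubP => [j _ _|]; rewrite ?mxE ?mulr0. Qed.

Lemma coords_inj (F : fieldType) d (x y : 'rV[F]_d) :
  (forall k, (k < d)%N -> coords x k = coords y k) -> x = y.
Proof. by move=> xy; apply/rowP => k; rewrite -!coords_ord xy. Qed.


(** * Algebras of equal type *)

Section NonIsomorphic.
Variables (F : fieldType) (i : F).

Local Notation "x .[ k ]" := (@coords F 4 x k) : ring_scope.

Let e_neq0 : (e 4 : 'rV[F]_4) <> 0.
Proof.
move/rowP/(_ (Ordinal (isT : 3 < 4)%N)); rewrite !mxE /=.
by apply/eqP; rewrite oner_neq0.
Qed.

(* The identity [(x^2)^2 = 0] holds in [L1_2_1'] only. *)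
Lemma L1_2_1_noniso : i ^+ 2 = -1 ->
  ~ isomorphic (label_algebra i L1_2_1) (label_algebra i L1_2_1').
Proof.
pose A := label_algebra i L1_2_1; pose B := label_algebra i L1_2_1'.
move=> i2 [f fb fM].
have mulE u v (w := amul B u v) : (w.[0] = 0) * (w.[1] = u.[0] * v.[0]) *
    (w.[2] = i * u.[0] * v.[0]) * (w.[3] = u.[1] * v.[1] + u.[2] * v.[2]).
  rewrite /w !coords_evo_mul // unlock /= ?(coordsD, coordsZ, coords0) !coords_e //=.
  by do !split; ring.
apply: e_neq0; apply: (bij_inj fb); rewrite linear0.
have -> : e 4 = amul A (e 2) (e 2) by rewrite evo_mul_e.
have -> : e 2 = amul A (e 1) (e 1) by rewrite evo_mul_e.
rewrite !fM -/B; apply: coords_inj; case_ord=> _; rewrite coords0 !mulE; try ring.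
set x := _.[0]; transitivity ((1 + i ^+ 2) * x ^+ 4); first by ring.
by rewrite i2; ring.
Qed.

(* In [L1_1_2'] the equations [u v = 0] and [u^2 = v^2] satisfied by [e_1] and
   [e_2] in [L1_1_2] force [(u^2)^2 = 0]. *)
Lemma L1_1_2_noniso : ~ isomorphic (label_algebra i L1_1_2) (label_algebra i L1_1_2').
Proof.
pose A := label_algebra i L1_1_2; pose B := label_algebra i L1_1_2'.
move=> [f fb fM].
have mulE u v (w := amul B u v) : (w.[0] = 0) * (w.[1] = 0) *
    (w.[2] = u.[0] * v.[0] + u.[1] * v.[1]) * (w.[3] = u.[1] * v.[1] + u.[2] * v.[2]).
  rewrite /w !coords_evo_mul // unlock /= ?(coordsD, coordsZ, coords0) !coords_e //=.
  by do !split; ring.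
pose u := f (e 1); pose v := f (e 2).
have e3E : e 3 = amul A (e 1) (e 1) by rewrite evo_mul_e.
have e4E : e 4 = amul A (e 3) (e 3) by rewrite evo_mul_e.
have uv0 : amul B u v = 0 by rewrite -fM evo_mul_e // linear0.
have uuvv : amul B u u = amul B v v by rewrite -!fM !evo_mul_e.
have uw0 : amul B u (amul B u u) = 0 by rewrite -!fM -e3E evo_mul_e // linear0.
have vw0 : amul B v (amul B u u) = 0 by rewrite -!fM -e3E evo_mul_e // linear0.
have ww0 : amul B (amul B u u) (amul B u u) <> 0.
  by rewrite -!fM -e3E -e4E -(linear0 f) => /(bij_inj fb).
(* [s] is the [e_3]-coordinate of [u^2], and [(u^2)^2 = s^2 e_4]. *)
pose s := u.[0] ^+ 2 + u.[1] ^+ 2.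
have s0 : s != 0.
  apply/eqP => s0; apply: ww0; apply: coords_inj; case_ord=> _;
    rewrite coords0 !mulE; try ring.
  by transitivity (s ^+ 2); [rewrite /s; ring | rewrite s0; ring].
have get k (x y : 'rV[F]_4) : x = y -> x.[k] = y.[k] by move->.
(* The last coordinate of [u u^2] is [s] times the third coordinate of [u]; likewise for [v]. *)
have u2 : u.[2] = 0.
  move/(get 3%N): uw0; rewrite coords0 !mulE mulr0 add0r -!expr2 -/s => /eqP.
  by rewrite mulf_eq0 (negPf s0) orbF => /eqP.
have v2 : v.[2] = 0.
  move/(get 3%N): vw0; rewrite coords0 !mulE mulr0 add0r -!expr2 -/s => /eqP.
  by rewrite mulf_eq0 (negPf s0) orbF => /eqP.
(* What remains says that, in each of the first two coordinates, [u] and [v] have product zero and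
   equal squares, so both coordinates of [u] vanish and [s = 0]. *)
have := get 2%N _ _ uv0; have := get 3%N _ _ uv0; have := get 2%N _ _ uuvv.
have := get 3%N _ _ uuvv; rewrite !coords0 !mulE u2 v2 mulr0 !addr0 => uv11 uv00 uv1.
rewrite uv1 addr0 => uv0'; move: uv00; rewrite uv11 => /addIr uv00.
have sq0 (x y : F) : x * y = 0 -> x * x = y * y -> x = 0.
  move/eqP; rewrite mulf_eq0 => /orP[] /eqP-> // /eqP.
  by rewrite mulr0 mulf_eq0 orbb => /eqP.
by case/eqP: s0; rewrite /s (sq0 _ _ uv1 uv11) (sq0 _ _ uv0' uv00) expr0n addr0.
Qed.

(* In [L1_1_1_1'] the equations [u u^2 = 0] and [u^2 (u^2)^2 = 0] satisfied by
   [e_1] in [L1_1_1_1] force [((u^2)^2)^2 = 0]. *)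
Lemma L1_1_1_1_noniso :
  ~ isomorphic (label_algebra i L1_1_1_1) (label_algebra i L1_1_1_1').
Proof.
pose A := label_algebra i L1_1_1_1; pose B := label_algebra i L1_1_1_1'.
move=> [f fb fM].
have mulE u v (w := amul B u v) : (w.[0] = 0) * (w.[1] = u.[0] * v.[0]) *
    (w.[2] = u.[0] * v.[0] + u.[1] * v.[1]) * (w.[3] = u.[2] * v.[2]).
  rewrite /w !coords_evo_mul // unlock /= ?(coordsD, coordsZ, coords0) !coords_e //=.
  by do !split; ring.
pose u := f (e 1).
have e2E : e 2 = amul A (e 1) (e 1) by rewrite evo_mul_e.
have e3E : e 3 = amul A (e 2) (e 2) by rewrite evo_mul_e.
have e4E : e 4 = amul A (e 3) (e 3) by rewrite evo_mul_e.
pose v := amul B u u; pose w := amul B v v.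
have uv0 : amul B u v = 0 by rewrite /v -!fM -e2E evo_mul_e // linear0.
have vw0 : amul B v w = 0 by rewrite /w /v -!fM -e2E -e3E evo_mul_e // linear0.
have ww0 : amul B w w <> 0.
  by rewrite /w /v -!fM -e2E -e3E -e4E -(linear0 f) => /(bij_inj fb).
have u0 : u.[0] != 0.
  apply/eqP => u0; apply: ww0; apply: coords_inj.
  by rewrite /w /v; case_ord=> _; rewrite coords0 !mulE ?u0; ring.
have get k (x y : 'rV[F]_4) : x = y -> x.[k] = y.[k] by move->.
(* The [e_3]-coordinate of [u u^2] is [u_1 u_0^2], with coordinates numbered from zero. *)
have u1 : u.[1] = 0.
  move/(get 2%N): uv0; rewrite /v coords0 !mulE mulr0 add0r => /eqP.
  by rewrite !mulf_eq0 !(negPf u0) !orbF => /eqP.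
(* With [u_1 = 0], the last coordinate of [v w] is [u_0^6], which cannot vanish. *)
move/(get 3%N): vw0; rewrite /w /v coords0 !mulE u1 !(mul0r, addr0, add0r) => /eqP.
by rewrite !mulf_eq0 !(negPf u0).
Qed.

End NonIsomorphic.

(** * Uniqueness of the normal form and the classification *)

Lemma label_isomorphic_inj (F : fieldType) (i : F) l l' : i ^+ 2 = -1 ->
  isomorphic (label_algebra i l) (label_algebra i l') -> l = l'.
Proof.
move=> i2 iso.
have := has_type_inj (has_type_iso iso (has_type_label i l)) (has_type_label i l').
have iso' := isomorphic_sym iso.
have := L1_2_1_noniso i2; have := @L1_1_2_noniso F i; have := @L1_1_1_1_noniso F i.
by case: l iso iso'; case: l' => // iso iso' n1 n2 n3 _;
  by [case: (n1 iso) | case: (n1 iso') | case: (n2 iso) | case: (n2 iso')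
     | case: (n3 iso) | case: (n3 iso')].
Qed.

Unset Implicit Arguments.

Theorem theorem5p1 (F : closedFieldType) (i : F)
    (char_neq2 : 2%N \notin [pchar F]) (i2 : i ^+ 2 = -1) :
  (forall l : label, has_type (label_algebra i l) (label_type l)) /\
  (forall E : algebra F,
     evolution_algebra E -> (0 < \dim (@fullv F E) <= 4)%N ->
     nilpotent E -> ~ decomposable E ->
     exists! l : label, isomorphic E (label_algebra i l)).
Proof.
split=> [l | E evoE dimE nilE indecE]; first exact: has_type_label.
have [s upper_s isoE] := nilpotent_evolution_algebra evoE nilE.
have [dec | [l isol]] := evo_classification i2 dimE upper_s.
  by case: indecE; apply: decomposable_iso (isomorphic_sym isoE) dec.
exists l; split=> [|l' isol']; first exact: isomorphic_trans isoE isol.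
apply: (label_isomorphic_inj i2); apply: isomorphic_trans isol'.
exact/isomorphic_sym/(isomorphic_trans isoE).
Qed.
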